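(* Let $b=(b_k)_{k\ge 0}$ be a non-decreasing sequence of real numbers with $b_0=1$, and let $\mathbb B$ be the quaternionic unit ball. Then $\mathcal{HM}_b(\mathbb B)$ is a right quaternionic reproducing kernel Hilbert space, whose reproducing kernel is $$K_b(q,p)=\sum_{k=0}^\infty\frac{Q_k(q)\overline{Q_k(p)}}{b_k},\qquad (q,p)\in\mathbb B\times\mathbb B.$$ Furthermore, the family $\left\{\psi^b_k:=\frac{Q_k}{\sqrt{b_k}}:\ k\ge 0\right\}$ forms an orthonormal basis of $\mathcal{HM}_b(\mathbb B)$.
   Context: $\mathbb H$ denotes the quaternions and $\mathbb B=\{q\in\mathbb H:|q|<1\}$. For $k\ge 0$, $Q_k(q)=\sum_{j=0}^k T^k_j\,q^{k-j}\overline q^{\,j}$ with $T^k_j=\frac{2(k-j+1)}{(k+1)(k+2)}$. The space is $$\mathcal{HM}_b(\mathbb B)=\left\{\sum_{k=0}^\infty Q_k\alpha_k:\ \alpha_k\in\mathbb H,\ \sum_{k=0}^\infty b_k|\alpha_k|^2<\infty\right\},$$ a set of functions on $\mathbb B$, with inner product $\langle f,g\rangle=\sum_{k=0}^\infty b_k\overline{\alpha_k}\beta_k$ for $f=\sum Q_k\alpha_k$, $g=\sum Q_k\beta_k$. The reproducing property reads $\langle K_b(\cdot,p),f\rangle=f(p)$ for all $f\in\mathcal{HM}_b(\mathbb B)$ and $p\in\mathbb B$, with $K_b(\cdot,p)\in\mathcal{HM}_b(\mathbb B)$. *)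

(* Defs.v *)
From HB Require Import structures.
From mathcomp Require Import all_boot all_order all_algebra ring lra.
From mathcomp Require Import all_classical all_reals all_analysis.

Set Implicit Arguments.
Unset Strict Implicit.
Unset Printing Implicit Defensive.

Import Order.TTheory GRing.Theory Num.Theory.
Import numFieldNormedType.Exports.

Local Open Scope classical_set_scope.
Local Open Scope ring_scope.

Record quat (R : Type) := Quat { qre : R; qi : R; qj : R; qk : R }.
Add Printing Constructor quat.

Definition quat_to_tuple {R : Type} (q : quat R) : R * R * R * R :=
  (qre q, qi q, qj q, qk q).
Definition quat_of_tuple {R : Type} (t : R * R * R * R) : quat R :=
  Quat t.1.1.1 t.1.1.2 t.1.2 t.2.

Lemma quat_to_tupleK {R : Type} : cancel (@quat_to_tuple R) (@quat_of_tuple R).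
Proof. by case. Qed.

HB.instance Definition _ (R : choiceType) :=
  Choice.copy (quat R) (can_type (@quat_to_tupleK R)).

Section QuatAlgebra.
Variable R : realType.
Implicit Types p q r : quat R.

Definition quat_add p q :=
  Quat (qre p + qre q) (qi p + qi q) (qj p + qj q) (qk p + qk q).
Definition quat_opp q := Quat (- qre q) (- qi q) (- qj q) (- qk q).
Definition quat_zero : quat R := Quat 0 0 0 0.
Definition quat_one : quat R := Quat 1 0 0 0.
Definition quat_scale (a : R) q :=
  Quat (a * qre q) (a * qi q) (a * qj q) (a * qk q).
Definition quat_mul p q := Quat
  (qre p * qre q - qi p * qi q - qj p * qj q - qk p * qk q)
  (qre p * qi q + qi p * qre q + qj p * qk q - qk p * qj q)
  (qre p * qj q - qi p * qk q + qj p * qre q + qk p * qi q)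
  (qre p * qk q + qi p * qj q - qj p * qi q + qk p * qre q).
Definition quat_conj q := Quat (qre q) (- qi q) (- qj q) (- qk q).

(* This becomes the norm [`|q|] through the normed module instance below. *)
Definition quat_norm q :=
  Num.sqrt (qre q ^+ 2 + qi q ^+ 2 + qj q ^+ 2 + qk q ^+ 2).

Lemma quat_addA : associative quat_add.
Proof. by move=> p q r; rewrite /quat_add /= !addrA. Qed.
Lemma quat_addC : commutative quat_add.
Proof. by move=> p q; congr Quat; exact: addrC. Qed.
Lemma quat_add0 : left_id quat_zero quat_add.
Proof. by case=> *; rewrite /quat_add /= !add0r. Qed.
Lemma quat_addN : left_inverse quat_zero quat_opp quat_add.
Proof. by case=> *; rewrite /quat_add /= !addNr. Qed.

HB.instance Definition _ :=
  GRing.isZmodule.Build (quat R) quat_addA quat_addC quat_add0 quat_addN.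

Lemma quat_mulA : associative quat_mul.
Proof. by move=> p q r; rewrite /quat_mul /quat_add /=; congr Quat; ring. Qed.
Lemma quat_mul1 : left_id quat_one quat_mul.
Proof. by case=> *; rewrite /quat_mul /=; congr Quat; ring. Qed.
Lemma quat_mulr1 : right_id quat_one quat_mul.
Proof. by case=> *; rewrite /quat_mul /=; congr Quat; ring. Qed.
Lemma quat_mulDl : left_distributive quat_mul quat_add.
Proof. by move=> p q r; rewrite /quat_mul /quat_add /=; congr Quat; ring. Qed.
Lemma quat_mulDr : right_distributive quat_mul quat_add.
Proof. by move=> p q r; rewrite /quat_mul /quat_add /=; congr Quat; ring. Qed.
Lemma quat_one_neq0 : quat_one != 0 :> quat R.
Proof. by apply/eqP => -[] /eqP; rewrite oner_eq0. Qed.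

HB.instance Definition _ :=
  GRing.Zmodule_isNzRing.Build (quat R) quat_mulA quat_mul1 quat_mulr1
    quat_mulDl quat_mulDr
    quat_one_neq0.

Lemma quat_scaleA a b q : quat_scale a (quat_scale b q) = quat_scale (a * b) q.
Proof. by rewrite /quat_scale /= !mulrA. Qed.
Lemma quat_scale1 : left_id 1 quat_scale.
Proof. by case=> *; rewrite /quat_scale /= !mul1r. Qed.
Lemma quat_scaleDr : right_distributive quat_scale quat_add.
Proof. by move=> a p q; rewrite /quat_scale /quat_add /= !mulrDr. Qed.
Lemma quat_scaleDl q a b : 
  quat_scale (a + b) q = quat_add (quat_scale a q) (quat_scale b q).
Proof. by rewrite /quat_scale /quat_add /= !mulrDl. Qed.

HB.instance Definition _ := GRing.Zmodule_isLmodule.Build R (quat R)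
  quat_scaleA quat_scale1 quat_scaleDr quat_scaleDl.

Lemma quat_scaleAl (a : R) p q : a *: (p * q) = (a *: p) * q.
Proof. by congr Quat => /=; ring. Qed.
HB.instance Definition _ := GRing.Lmodule_isLalgebra.Build R (quat R) quat_scaleAl.

Lemma quat_scaleAr (a : R) p q : a *: (p * q) = p * (a *: q).
Proof. by congr Quat => /=; ring. Qed.
HB.instance Definition _ := GRing.Lalgebra_isAlgebra.Build R (quat R) quat_scaleAr.

Lemma quat_norm_ge0 q : 0 <= quat_norm q. Proof. exact: sqrtr_ge0. Qed.

Lemma sqr_quat_norm q :
  quat_norm q ^+ 2 = qre q ^+ 2 + qi q ^+ 2 + qj q ^+ 2 + qk q ^+ 2.
Proof. by rewrite sqr_sqrtr// !addr_ge0// sqr_ge0. Qed.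

Lemma quat_norm_eq0 q : quat_norm q = 0 -> q = 0.
Proof.
move=> q0; have := sqr_quat_norm q; rewrite q0 expr0n/= => /esym/eqP.
rewrite !paddr_eq0 ?addr_ge0 ?sqr_ge0// !sqrf_eq0.
by case: q {q0} => a b c d /= /andP[/andP[/andP[/eqP-> /eqP->] /eqP->] /eqP->].
Qed.

Lemma quat_normZ (a : R) q : quat_norm (a *: q) = `|a| * quat_norm q.
Proof. by rewrite /quat_norm /= !exprMn -!mulrDr sqrtrM ?sqr_ge0// sqrtr_sqr. Qed.

Lemma quat_normD p q : quat_norm (p + q) <= quat_norm p + quat_norm q.
Proof.
rewrite -(@ler_pXn2r _ 2)// ?nnegrE ?addr_ge0 ?quat_norm_ge0//.
rewrite sqrrD !sqr_quat_norm /=.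
set s := quat_norm p * quat_norm q.
have s0 : 0 <= s by rewrite mulr_ge0 ?quat_norm_ge0.
set t := qre p * qre q + qi p * qi q + qj p * qj q + qk p * qk q.
have ts : t <= s.
  have [t0|t0] := ltP t 0; first by rewrite (le_trans (ltW t0)).
  rewrite -(@ler_pXn2r _ 2)// ?nnegrE// /s exprMn !sqr_quat_norm -subr_ge0.
  (* Lagrange's identity *)
  have -> : forall a b c d x y z w : R,
      (a ^+ 2 + b ^+ 2 + c ^+ 2 + d ^+ 2) * (x ^+ 2 + y ^+ 2 + z ^+ 2 + w ^+ 2)
      - (a * x + b * y + c * z + d * w) ^+ 2
    = (a * y - b * x) ^+ 2 + (a * z - c * x) ^+ 2 + (a * w - d * x) ^+ 2
    + (b * z - c * y) ^+ 2 + (b * w - d * y) ^+ 2 + (c * w - d * z) ^+ 2.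
    by move=> *; ring.
  by rewrite !addr_ge0// sqr_ge0.
by rewrite /t in ts *; nra.
Qed.

HB.instance Definition _ :=
  Lmodule_isNormed.Build R (quat R) quat_normD quat_normZ quat_norm_eq0.

End QuatAlgebra.

Section RightHilbert.
Variables (R : realType) (T : Type).
Implicit Types (V : set (T -> quat R)) (f g : T -> quat R).

Definition scaler f (a : quat R) : T -> quat R := fun x => f x * a.

Definition is_right_subspace V : Prop :=
  [/\ V 0, forall f g, V f -> V g -> V (f + g)
    & forall f a, V f -> V (scaler f a)].

Variable ip : (T -> quat R) -> (T -> quat R) -> quat R.

(* Hermitian and right linear in the second argument.  By Hermitian symmetry
   [ip f f] is a real quaternion, so its sign is that of its real part. *)
Definition is_right_inner_product V : Prop :=
  [/\ forall f g h, V f -> V g -> V h -> ip f (g + h) = ip f g + ip f h,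
      forall f g a, V f -> V g -> ip f (scaler g a) = ip f g * a,
      forall f g, V f -> V g -> ip g f = quat_conj (ip f g),
      forall f, V f -> 0 <= qre (ip f f)
    & forall f, V f -> ip f f = 0 -> f = 0].

Definition ipnorm f : R := Num.sqrt (qre (ip f f)).

Definition is_ip_complete V : Prop :=
  forall u : nat -> T -> quat R, (forall n, V (u n)) ->
    (forall e : R, 0 < e -> exists N, forall m n, (N <= m)%N -> (N <= n)%N ->
      ipnorm (u m - u n) < e) ->
    exists2 f, V f & ipnorm (u n - f) @[n --> \oo] --> 0.

Definition is_right_hilbert V : Prop :=
  [/\ is_right_subspace V, is_right_inner_product V & is_ip_complete V].

Definition has_bounded_evaluations V : Prop :=
  forall x : T, exists C : R, forall f, V f -> `|f x| <= C * ipnorm f.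

Definition is_rkhs V : Prop := is_right_hilbert V /\ has_bounded_evaluations V.

(* [K q p] is the value at q of the kernel function attached to p. *)
Definition is_reproducing_kernel V (K : T -> T -> quat R) : Prop :=
  forall p, V (K^~ p) /\ forall f, V f -> ip (K^~ p) f = f p.

Definition is_orthonormal_basis V (e : nat -> T -> quat R) : Prop :=
  [/\ forall k, V (e k),
      forall j k, ip (e j) (e k) = (j == k)%:R
    & (* totality: finite right linear combinations are dense *)
      forall f, V f -> forall eps : R, 0 < eps ->
      exists (n : nat) (c : nat -> quat R),
        ipnorm (f - \sum_(k < n) scaler (e k) (c k)) < eps].

End RightHilbert.

Definition qball (R : realType) := {q : quat R | `|q| < 1}.

Section HM.
Variable R : realType.
Local Notation B := (qball R).

Definition Tcoef (k j : nat) : R :=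
  (2 * (k - j + 1)%:R) / ((k + 1)%:R * (k + 2)%:R).

Definition Q (k : nat) (q : B) : quat R :=
  \sum_(j < k.+1) Tcoef k j *: (val q ^+ (k - j) * quat_conj (val q) ^+ j).

Variable b : nat -> R.

Definition b_summable (a : nat -> quat R) : Prop :=
  (\sum_(0 <= k <oo) (b k * `|a k| ^+ 2)%:E < +oo)%E.

(* The sum of functions is pointwise on the ball, in the Euclidean norm of
   the quaternions. *)
Definition is_Qsum (a : nat -> quat R) (f : B -> quat R) : Prop :=
  forall q, series (fun k => Q k q * a k) @ \oo --> f q.

Definition HM : set (B -> quat R) :=
  [set f | exists2 a, b_summable a & is_Qsum a f].

(* Coefficients are unique, but that is a theorem: here one sequence is chosen
   (zero when f is not in [HM]). *)
Definition Qcoef (f : B -> quat R) : nat -> quat R :=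
  xget (fun=> 0) [set a | b_summable a /\ is_Qsum a f].

Definition ipHM (f g : B -> quat R) : quat R :=
  limn (series (fun k => b k *: (quat_conj (Qcoef f k) * Qcoef g k))).

Definition Kterm (q p : B) (k : nat) : quat R :=
  (b k)^-1 *: (Q k q * quat_conj (Q k p)).

Definition K (q p : B) : quat R := limn (series (Kterm q p)).

Definition psi (k : nat) : B -> quat R := (Num.sqrt (b k))^-1 *: Q k.

End HM.

(* Main.v *)
Require Import Defs.
From HB Require Import structures.
From mathcomp Require Import all_boot all_order all_algebra ring lra.
From mathcomp Require Import all_classical all_reals all_analysis.
Import Order.TTheory GRing.Theory Num.Theory.
Import numFieldNormedType.Exports.

Set Implicit Arguments.
Unset Strict Implicit.
Unset Printing Implicit Defensive.

Local Open Scope classical_set_scope.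
Local Open Scope ring_scope.

(** Everything is done on coefficient sequences.  The real numbers
    [Tcoef R k j], [j <= k], are nonnegative and sum to 1, so that
    [|Q k q| <= |q| ^+ k], with [Q k x = x ^+ k] at a real point [x].  Since
    [b] is nondecreasing from [b 0 = 1], all weights are at least 1, hence a
    weighted square-summable [a] is bounded, and the series of the [Q k q * a k]
    is dominated on the ball by a geometric one ([Qseries_bounded]): it
    converges, the quaternions being complete.  Restricting a sum to the real
    points of the ball turns it into a power series, which determines its
    coefficients ([Qsum_eq0_coef]).  The space is therefore in linear bijection
    with the weighted l2 space of sequences ([expands], [expands_unique]), and
    [ipHM b f f] is the weighted sum of the squared norms of the coefficients of
    [f].

    The rest is the classical theory of weighted l2.  The inner product converges
    by the inequality [2 x y <= x^2 + y^2]; the space is complete because Cauchy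
    sequences converge coefficientwise, with uniform bounds on the partial sums
    ([HM_complete]).  Evaluation at [q] is bounded by [1 / (1 - |q|)], each
    coefficient being bounded by the norm.  The function [K b ^~ p] has
    coefficients [(b k)^-1 *: quat_conj (Q k p)], and pairing these with the
    coefficients of [f] gives back the series of [f p].  Finally [psi b k] has a
    single nonzero coefficient, and the partial sums of an expansion of [f]
    approximate [f] in norm because the tails of a convergent series tend to 0. *)

(** * Quaternions as a complete normed algebra *)

Section QuaternionNorm.
Variable R : realType.
Implicit Types p q : quat R.

Lemma sqr_normq q : `|q| ^+ 2 = qre q ^+ 2 + qi q ^+ 2 + qj q ^+ 2 + qk q ^+ 2.
Proof. exact: sqr_quat_norm. Qed.

Lemma normq_conj q : `|quat_conj q| = `|q|.
Proof.
apply/eqP; rewrite -(@eqrXn2 _ 2)// !sqr_normq /=; apply/eqP; ring.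
Qed.

Lemma normqM p q : `|p * q| = `|p| * `|q|.
Proof.
apply/eqP; rewrite -(@eqrXn2 _ 2)// ?mulr_ge0// exprMn !sqr_normq /=.
by apply/eqP; ring.
Qed.

Lemma normq1 : `|1 : quat R| = 1.
Proof. by apply/eqP; rewrite -(@eqrXn2 _ 2)// sqr_normq /=; apply/eqP; ring. Qed.

Lemma normqX q n : `|q ^+ n| = `|q| ^+ n.
Proof.
by elim: n => [|n IHn]; rewrite ?expr0 ?normq1// !exprS normqM IHn.
Qed.

Lemma quat_conjM p q : quat_conj (p * q) = quat_conj q * quat_conj p.
Proof. by congr Quat => /=; ring. Qed.

Lemma quat_conjK : involutive (@quat_conj R).
Proof. by case=> *; rewrite /quat_conj /= !opprK. Qed.

Lemma quat_conjZ (x : R) q : quat_conj (x *: q) = x *: quat_conj q.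
Proof. by congr Quat => /=; ring. Qed.

Lemma mul_conj_quat q : quat_conj q * q = `|q| ^+ 2 *: 1.
Proof. by rewrite sqr_normq; congr Quat => /=; ring. Qed.

Lemma quat_conj_is_zmod_morphism : zmod_morphism (@quat_conj R).
Proof. by move=> p q; congr Quat => /=; ring. Qed.

HB.instance Definition _ :=
  GRing.isZmodMorphism.Build (quat R) (quat R) (@quat_conj R)
    quat_conj_is_zmod_morphism.

Lemma ler_normq_comp q :
  [/\ `|qre q| <= `|q|, `|qi q| <= `|q|, `|qj q| <= `|q| & `|qk q| <= `|q|].
Proof.
by split; rewrite -(@ler_pXn2r _ 2)// ?nnegrE// sqr_normq real_normK ?num_real//;
  nra.
Qed.

Lemma ler_normq_sum q : `|q| <= `|qre q| + `|qi q| + `|qj q| + `|qk q|.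
Proof.
rewrite -(@ler_pXn2r _ 2)// ?nnegrE ?addr_ge0// sqr_normq.
rewrite -(real_normK (num_real (qre q))) -(real_normK (num_real (qi q))).
rewrite -(real_normK (num_real (qj q))) -(real_normK (num_real (qk q))).
move: (normr_ge0 (qre q)) (normr_ge0 (qi q)) (normr_ge0 (qj q)).
by move: (normr_ge0 (qk q)); nra.
Qed.

(** The real components are 1-Lipschitz, so a Cauchy filter has Cauchy images in
    the reals; the limits of these are the components of its limit, since the
    norm is at most the sum of the absolute values of the components. *)
Lemma quat_complete (F : set_system (quat R)) :
  ProperFilter F -> cauchy F -> cvg F.
Proof.
move=> FF /cauchyP Fc.
have comp (g : quat R -> R) : (forall p q, `|g p - g q| <= `|p - q|) ->
    cvg (g @ F).
  move=> gL; apply/cauchy_cvgP/cauchyP => e e0.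
  have [q Fq] := Fc e e0; exists (g q).
  have : F (g @^-1` ball (g q) e); last by [].
  apply: filterS Fq => p; rewrite /preimage -!ball_normE/=.
  by apply: le_lt_trans; exact: gL.
have cre := comp _ (fun p q => let: And4 h _ _ _ := ler_normq_comp (p - q) in h).
have ci := comp _ (fun p q => let: And4 _ h _ _ := ler_normq_comp (p - q) in h).
have cj := comp _ (fun p q => let: And4 _ _ h _ := ler_normq_comp (p - q) in h).
have ck := comp _ (fun p q => let: And4 _ _ _ h := ler_normq_comp (p - q) in h).
apply/cvg_ex; exists (Quat (lim (@qre R @ F)) (lim (@qi R @ F))
  (lim (@qj R @ F)) (lim (@qk R @ F))).
apply/cvgrPdist_le => e e0.
have e4 : 0 < e / 4 by rewrite divr_gt0.
move/cvgrPdist_le : cre => /(_ _ e4) cre.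
move/cvgrPdist_le : ci => /(_ _ e4) ci.
move/cvgrPdist_le : cj => /(_ _ e4) cj.
move/cvgrPdist_le : ck => /(_ _ e4) ck.
near=> q; apply: le_trans (ler_normq_sum _) _ => /=.
have -> : e = e / 4 + e / 4 + e / 4 + e / 4 by field.
by rewrite !lerD//; near: q.
Unshelve. all: by end_near. Qed.

HB.instance Definition _ := Uniform_isComplete.Build (quat R) quat_complete.

End QuaternionNorm.

(** * Series in normed modules and in the quaternions *)

Section Series.
Variable R : realType.

(** A bounded additive map is Lipschitz and commutes with partial sums.  This
    covers at once right multiplication by a quaternion, conjugation and the
    embedding of the real numbers. *)
Lemma cvg_series_morph (V W : normedModType R) (g : V -> W) (C : R)
    (u : nat -> V) (l : V) :
    {morph g : x y / x + y} -> (forall x, `|g x| <= C * `|x|) ->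
  series u @ \oo --> l -> series (g \o u) @ \oo --> g l.
Proof.
move=> gD gC ul.
have g0 : g 0 = 0.
  by apply/eqP; rewrite -normr_le0 (le_trans (gC 0))// normr0 mulr0.
have -> : series (g \o u) = g \o series u.
  by apply/funext => n; rewrite /series /= (big_morph g gD g0).
apply/cvgrPdist_le => e e0.
have C0 : 0 < `|C| + 1 by rewrite ltr_wpDl.
have e1 : 0 < e / (`|C| + 1) by rewrite divr_gt0.
move/cvgrPdist_le : ul => /(_ _ e1); apply: filterS => n.
rewrite ler_pdivlMr// => ne /=.
have -> : g l - g (series u n) = g (l - series u n).
  by apply/eqP; rewrite subr_eq -gD subrK.
rewrite (le_trans (gC _))// (le_trans _ ne)// mulrC ler_wpM2l//.
by rewrite (le_trans (ler_norm C))// lerDl.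
Qed.

(** The Weierstrass test, in a form that also bounds the sum. *)
Lemma cvg_series_dominated (V : completeNormedModType R) (u : nat -> V)
    (v : nat -> R) (l : R) :
    (forall k, `|u k| <= v k) -> series v @ \oo --> l ->
  cvgn (series u) /\ `|limn (series u)| <= l.
Proof.
move=> uv vl.
have v0 k : 0 <= v k by rewrite (le_trans _ (uv k)).
have cu : cvgn (series u).
  apply: normed_cvg; apply: (@series_le_cvg _ _ v) => //=.
  exact: cvgP vl.
split=> //.
have ncu : (fun n => `|series u n|) @ \oo --> `|limn (series u)|.
  exact: cvg_norm.
rewrite -(cvg_lim _ ncu)//; apply: limr_le; first exact: cvgP ncu.
apply: nearW => n.
rewrite (le_trans (ler_norm_sum _ _ _))//.
rewrite (le_trans (ler_sum _ (fun k _ => uv k)))//.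
rewrite -(cvg_lim _ vl)//; apply: nondecreasing_cvgn_le.
  by apply: nondecreasing_series.
exact: cvgP vl.
Qed.

Lemma cvg_series_delta (V : normedModType R) (x : V) k :
  series (fun j => if j == k then x else 0) @ \oo --> x.
Proof.
apply: cvg_near_cst; exists k.+1 => // n /= kn.
by rewrite /series /= -big_mkcond big_nat1_eq /= kn.
Qed.

Lemma cvg_series_mulq (u : nat -> quat R) (l x : quat R) :
  series u @ \oo --> l -> series (fun k => u k * x) @ \oo --> l * x.
Proof.
apply: (@cvg_series_morph _ _ (fun y : quat R => y * x) `|x|).
- by move=> y z; rewrite mulrDl.
- by move=> y; rewrite normqM mulrC.
Qed.

Lemma cvg_series_conj (u : nat -> quat R) (l : quat R) :
  series u @ \oo --> l ->
  series (fun k => quat_conj (u k)) @ \oo --> quat_conj l.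
Proof.
apply: (@cvg_series_morph _ _ (@quat_conj R) 1).
- by move=> y z; rewrite raddfD.
- by move=> y; rewrite normq_conj mul1r.
Qed.

Lemma cvg_series_scale1 (u : nat -> R) (l : R) :
  series u @ \oo --> l ->
  series (fun k => u k *: (1 : quat R)) @ \oo --> l *: (1 : quat R).
Proof.
apply: (@cvg_series_morph _ _ (fun x : R => x *: (1 : quat R)) 1).
- by move=> x y; rewrite scalerDl.
- by move=> x; rewrite normrZ normq1 mulr1 mul1r.
Qed.

End Series.

(** * The polynomials Q and uniqueness of coefficients *)

Section QuaternionicPolynomials.
Variable R : realType.
Local Notation B := (qball R).

(** The numerators run through twice [1, ..., k + 1], whose sum is
    [(k + 1) * (k + 2)]. *)
Lemma sum_Tcoef k : \sum_(j < k.+1) Tcoef R k j = 1.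
Proof.
have sumE n : 2 * \sum_(j < n.+1) (n - j + 1)%:R = (n + 1)%:R * (n + 2)%:R :> R.
  elim: n => [|n IHn]; first by rewrite big_ord1 mulr1 mul1r.
  rewrite big_ord_recl /= mulrDr.
  under eq_bigr do rewrite /bump /= add1n subSS.
  by rewrite IHn subn0 -addn1 !natrD; ring.
by rewrite /Tcoef -mulr_suml -mulr_sumr sumE divff.
Qed.

Lemma Tcoef_ge0 k j : 0 <= Tcoef R k j.
Proof. by rewrite /Tcoef divr_ge0// mulr_ge0. Qed.

Lemma normq_Q k (q : B) : `|Q k q| <= `|val q| ^+ k.
Proof.
rewrite (le_trans (ler_norm_sum _ _ _))//.
under eq_bigr => j _ do rewrite normrZ normqM !normqX normq_conj -exprD
  subnK -1?ltnS// ger0_norm ?Tcoef_ge0//.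
by rewrite -mulr_suml sum_Tcoef mul1r.
Qed.

(** A real quaternion is its own conjugate, so all the monomials of [Q k]
    coincide there. *)
Lemma Q_real k (q : B) (x : R) : val q = x *: 1 -> Q k q = x ^+ k *: 1.
Proof.
move=> qx; rewrite /Q qx.
have -> : quat_conj (x *: 1 : quat R) = x *: 1 by congr Quat => /=; ring.
under eq_bigr => j _ do rewrite -exprD subnK -1?ltnS// exprZn expr1n.
by rewrite -scaler_suml sum_Tcoef scale1r.
Qed.

Lemma Qseries_bounded (a : nat -> quat R) (M : R) (q : B) :
    (forall k, `|a k| <= M) ->
  cvgn (series (fun k => Q k q * a k)) /\
  `|limn (series (fun k => Q k q * a k))| <= M / (1 - `|val q|).
Proof.
move=> aM; apply: (@cvg_series_dominated _ _ _ (geometric M `|val q|)).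
  move=> k; rewrite normqM mulrC ler_pM//; exact: normq_Q.
by apply: cvg_geometric_series; rewrite normr_id (valP q).
Qed.

(** Let [k] be the first index with [d k != 0].  At a real point [x] the sum
    reads [x^k d_k + sum_(j > k) x^j d_j = 0], and the second term is at most a
    constant times [x^(k+1)]; letting [x] tend to 0 gives [d k = 0]. *)
Lemma Qsum_eq0_coef (d : nat -> quat R) (M : R) :
  (forall k, `|d k| <= M) -> is_Qsum d (fun=> 0) -> forall k, d k = 0.
Proof.
move=> dM d0; elim/ltn_ind => k IH; apply/eqP/negPn/negP; rewrite -normr_gt0.
set D := `|d k| => D0.
pose C := M * 2 ^+ k.+2.
have M0 : 0 < M by rewrite (lt_le_trans D0)// dM.
have C0 : 0 < C by rewrite mulr_gt0// exprn_gt0.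
suff DC x : 0 < x -> x <= 2^-1 -> D <= C * x.
  (* The point is at most 1/2, and there [C * x <= D / 2]. *)
  have DC0 : 0 < D + C by rewrite addr_gt0.
  have x0 : 0 < D / (2 * (D + C)) by rewrite divr_gt0// mulr_gt0.
  have x2 : D / (2 * (D + C)) <= 2^-1.
    rewrite ler_pdivrMr ?mulr_gt0// mulrA mulVf ?pnatr_eq0// mul1r; nra.
  have := DC _ x0 x2; rewrite mulrA ler_pdivlMr ?mulr_gt0//; nra.
move=> x0 x2.
have x1 : `|x *: 1 : quat R| < 1.
  by rewrite normrZ normq1 mulr1 gtr0_norm// (le_lt_trans x2)//; lra.
pose q : B := exist _ (x *: 1) x1.
have Qx j : Q j q = x ^+ j *: 1 by exact: Q_real.
pose u j := Q j q * d j.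
pose u' j := u j - (if j == k then u k else 0).
have cu' : series u' @ \oo --> 0 - u k.
  rewrite (_ : u' = u - (fun j => if j == k then u k else 0))// seriesD seriesN.
  by apply: cvgB; [exact: d0|exact: cvg_series_delta].
(* As [x <= 1/2], [x^j <= x^(k+1) * 2^-(j-k-1) = (2x)^(k+1) * 2^-j] when
   [j > k]; the terms of index at most [k] vanish. *)
have u'g j : `|u' j| <= geometric (M * (2 * x) ^+ k.+1) 2^-1 j.
  rewrite /u' /u /geometric/=.
  have [jk|kj|->] := ltngtP j k; last first.
  - by rewrite subrr normr0 !mulr_ge0// ?exprn_ge0// ?mulr_ge0// ltW.
  - rewrite subr0 Qx normqM normrZ normq1 mulr1 mulrC normrX gtr0_norm//.
    rewrite -mulrA; apply: ler_pM => //; first by rewrite exprn_ge0// ltW.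
    rewrite -{1 2}(subnKC kj) !exprD exprMn.
    have -> : 2 ^+ k.+1 * x ^+ k.+1 * (2^-1 ^+ k.+1 * 2^-1 ^+ (j - k.+1)) =
      x ^+ k.+1 * 2^-1 ^+ (j - k.+1) :> R.
      by rewrite exprVn; field; rewrite expf_neq0.
    by rewrite ler_pM2l ?exprn_gt0// lerXn2r// nnegrE ltW.
  - rewrite subr0 IH// mulr0 normr0 !mulr_ge0// ?exprn_ge0// ?mulr_ge0// ltW//.
have half1 : `|2^-1| < 1 :> R by rewrite ger0_norm//; lra.
have [_] := cvg_series_dominated u'g (cvg_geometric_series half1).
rewrite (cvg_lim _ cu')// sub0r normrN /u Qx normqM normrZ normq1 mulr1.
rewrite normrX gtr0_norm// -/D => Dx.
rewrite -(@ler_pM2l _ (x ^+ k)) ?exprn_gt0// (le_trans Dx)// /C exprMn.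
by rewrite le_eqVlt; apply/orP; left; apply/eqP; rewrite !exprS; field.
Qed.

End QuaternionicPolynomials.

(** * Weighted square-summable coefficients *)

Section Coefficients.
Variables (R : realType) (b : nat -> R).
Hypothesis b_nondecr : {homo b : m n / (m <= n)%N >-> m <= n}.
Hypothesis b0 : b 0%N = 1.
Local Notation B := (qball R).
Implicit Types (a c : nat -> quat R) (f g : B -> quat R).

Lemma b_ge1 k : 1 <= b k. Proof. by rewrite -b0 b_nondecr. Qed.

Lemma b_gt0 k : 0 < b k. Proof. exact: lt_le_trans (b_ge1 k). Qed.

Definition wsum a : nat -> R := series (fun k => b k * `|a k| ^+ 2).

Lemma wterm_ge0 a k : 0 <= b k * `|a k| ^+ 2.
Proof. by rewrite mulr_ge0 ?exprn_ge0// ltW// b_gt0. Qed.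

Lemma wsum_nondecr a : nondecreasing_seq (wsum a).
Proof. by apply: nondecreasing_series => k _ _; exact: wterm_ge0. Qed.

Lemma coef_le_wsum a k : `|a k| ^+ 2 <= wsum a k.+1.
Proof.
rewrite /wsum /series /= big_nat_recr//= -[leLHS]add0r lerD//.
  by apply: sumr_ge0 => j _; exact: wterm_ge0.
by rewrite ler_peMl ?exprn_ge0// b_ge1.
Qed.

(** Bounded partial sums are what passes to limits of coefficients and to sums
    of sequences. *)
Lemma b_summableP a : b_summable b a <-> exists M, forall n, wsum a n <= M.
Proof.
have w0 n : (0 <= n)%N -> true -> (0 <= (b n * `|a n| ^+ 2)%:E)%E.
  by move=> _ _; rewrite lee_fin wterm_ge0.
rewrite /b_summable; split=> [afin|[M aM]].
  exists (fine (\sum_(0 <= k <oo) (b k * `|a k| ^+ 2)%:E)%E) => n.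
  rewrite -lee_fin fineK; last first.
    by rewrite ge0_fin_numE//; apply: nneseries_ge0 => k; exact: w0.
  by rewrite /wsum /series /= -sumEFin; exact: nneseries_lim_ge.
apply: (@le_lt_trans _ _ M%:E); last exact: ltry.
apply: lime_le; first by apply: is_cvg_nneseries => k; exact: w0.
by apply: nearW => n; rewrite sumEFin lee_fin aM.
Qed.

(** Membership in the space with an explicit coefficient sequence: the
    operations on functions are read off on the sequences. *)
Definition expands a f := b_summable b a /\ is_Qsum a f.

Lemma HM_expands a f : expands a f -> HM b f.
Proof. by case=> as_ af; exists a. Qed.

Lemma cvg_wsum a : b_summable b a -> cvgn (wsum a).
Proof.
move=> /b_summableP[M aM]; apply: nondecreasing_is_cvgn; first exact: wsum_nondecr.
by exists M => _ [n _ <-].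
Qed.

Lemma b_summable_bounded a : b_summable b a -> exists M, forall k, `|a k| <= M.
Proof.
move=> /b_summableP[M aM]; exists (1 + M) => k.
have := le_trans (coef_le_wsum a k) (aM _).
move: (normr_ge0 (a k)); nra.
Qed.

(** Square-summable coefficients are bounded as the weights are at least 1, and
    bounded coefficients are enough on the open ball. *)
Lemma is_Qsum_series a :
  b_summable b a -> is_Qsum a (fun q => limn (series (fun k => Q k q * a k))).
Proof.
move=> /b_summable_bounded[M aM] q.
by have [] := Qseries_bounded q aM.
Qed.

Lemma expands_series a :
  b_summable b a -> expands a (fun q => limn (series (fun k => Q k q * a k))).
Proof. by move=> as_; split=> //; exact: is_Qsum_series. Qed.

Lemma summable0 : b_summable b 0.
Proof.
apply/b_summableP; exists 0 => n; rewrite /wsum /series /= big1// => k _.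
by rewrite normr0 expr0n mulr0.
Qed.

(** [(x + y)^2 <= 2 * (x^2 + y^2)]. *)
Lemma summableD a c : b_summable b a -> b_summable b c -> b_summable b (a + c).
Proof.
move=> /b_summableP[M aM] /b_summableP[N cN]; apply/b_summableP.
exists (2 * (M + N)) => n.
apply: (@le_trans _ _ (2 * (wsum a n + wsum c n))); last first.
  by rewrite ler_pM2l// lerD.
rewrite /wsum /series /= -big_split /= mulr_sumr; apply: ler_sum => k _.
rewrite -mulrDr [leRHS]mulrCA ler_pM2l ?b_gt0//.
apply: (@le_trans _ _ ((`|a k| + `|c k|) ^+ 2)).
  by rewrite lerXn2r ?nnegrE ?addr_ge0// ler_normD.
by rewrite -subr_ge0; have := sqr_ge0 (`|a k| - `|c k|); nra.
Qed.

Lemma summable_mulr a x : b_summable b a -> b_summable b (fun k => a k * x).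
Proof.
move=> /b_summableP[M aM]; apply/b_summableP; exists (M * `|x| ^+ 2) => n.
rewrite (_ : wsum _ n = wsum a n * `|x| ^+ 2).
  by rewrite ler_wpM2r ?exprn_ge0.
rewrite /wsum /series /= mulr_suml; apply: eq_bigr => k _.
by rewrite normqM exprMn mulrA.
Qed.

Lemma expands0 : expands 0 0.
Proof.
split=> [|q]; first exact: summable0.
have -> : series (fun k => Q k q * (0 : nat -> quat R) k) = cst 0.
  by apply/funext => n; rewrite /series /= big1// => k _; rewrite mulr0.
exact: cvg_cst.
Qed.

Lemma expandsD a c f g : expands a f -> expands c g -> expands (a + c) (f + g).
Proof.
move=> [as_ af] [cs cg]; split=> [|q]; first exact: summableD.
have -> : (fun k => Q k q * (a + c) k) =
    (fun k => Q k q * a k) + (fun k => Q k q * c k).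
  by apply/funext => k; rewrite !fctE mulrDr.
by rewrite seriesD; apply: cvgD.
Qed.

Lemma expandsZ a f x : expands a f -> expands (fun k => a k * x) (scaler f x).
Proof.
move=> [as_ af]; split=> [|q]; first exact: summable_mulr.
under eq_fun do rewrite mulrA.
exact: cvg_series_mulq (af q).
Qed.

Lemma expandsB a c f g : expands a f -> expands c g -> expands (a - c) (f - g).
Proof.
move=> af /(@expandsZ _ _ (-1)) cg.
have -> : a - c = a + (fun k => c k * -1).
  by apply/funext => k; rewrite !fctE mulrN1.
have -> : f - g = f + scaler g (-1).
  by apply/funext => q; rewrite !fctE /scaler mulrN1.
exact: expandsD.
Qed.

Lemma summable_delta (k : nat) (x : quat R) :
  b_summable b (fun j => if j == k then x else 0).
Proof.
apply/b_summableP; exists (b k * `|x| ^+ 2) => n.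
rewrite /wsum /series /=.
under eq_bigr => j _.
  have -> : b j * `|if j == k then x else 0| ^+ 2 =
      if j == k then b j * `|x| ^+ 2 else 0.
    by case: ifP => // _; rewrite normr0 expr0n mulr0.
  over.
rewrite -big_mkcond big_nat1_eq; case: ifP => // _.
by rewrite mulr_ge0 ?exprn_ge0// ltW// b_gt0.
Qed.

Lemma expands_monomial k (x : quat R) :
  expands (fun j => if j == k then x else 0) (fun q => Q k q * x).
Proof.
split=> [|q]; first exact: summable_delta.
rewrite (_ : (fun j => _) = (fun j => if j == k then Q k q * x else 0)).
  exact: cvg_series_delta.
by apply/funext => j; case: eqP => [->//|_]; rewrite mulr0.
Qed.

Lemma expands_unique a c f : expands a f -> expands c f -> a = c.
Proof.
move=> af cf; have [ds d0] := expandsB af cf.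
have [M dM] := b_summable_bounded ds.
rewrite subrr in d0.
apply/funext => k; apply/eqP; rewrite -subr_eq0; apply/eqP.
exact: (Qsum_eq0_coef dM d0).
Qed.

(** This removes the choice made in [Qcoef] from all later arguments. *)
Lemma Qcoef_expands a f : expands a f -> Qcoef b f = a.
Proof.
move=> af; apply: expands_unique (af).
have := @xgetPex _ (fun=> 0) [set a | b_summable b a /\ is_Qsum a f].
by apply; exists a.
Qed.

Lemma Qcoef_HM f : HM b f -> expands (Qcoef b f) f.
Proof. by case=> a as_ af; rewrite (@Qcoef_expands a). Qed.

(** * The inner product and the Hilbert space structure *)

(** Termwise, [b |a| |c| <= b |a|^2 + b |c|^2]. *)
Lemma ipHM_cvg a c f g : expands a f -> expands c g ->
  series (fun k => b k *: (quat_conj (a k) * c k)) @ \oo --> ipHM b f g.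
Proof.
move=> af cg; rewrite /ipHM (Qcoef_expands af) (Qcoef_expands cg).
have dom k : `|b k *: (quat_conj (a k) * c k)| <=
    ((fun k => b k * `|a k| ^+ 2) + (fun k => b k * `|c k| ^+ 2)) k.
  rewrite normrZ normqM normq_conj gtr0_norm ?b_gt0// !fctE -mulrDr.
  rewrite ler_pM2l ?b_gt0//.
  move: (normr_ge0 (a k)) (normr_ge0 (c k)); nra.
have cvgac : series ((fun k => b k * `|a k| ^+ 2) + (fun k => b k * `|c k| ^+ 2))
    @ \oo --> limn (wsum a) + limn (wsum c).
  by rewrite seriesD; apply: cvgD; apply: cvg_wsum; [case: af|case: cg].
by have [] := cvg_series_dominated dom cvgac.
Qed.

Lemma ipHM_eq a c f g l : expands a f -> expands c g ->
    series (fun k => b k *: (quat_conj (a k) * c k)) @ \oo --> l ->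
  ipHM b f g = l.
Proof.
move=> af cg cl; rewrite -(cvg_lim _ cl)//.
by rewrite -(cvg_lim _ (ipHM_cvg af cg)).
Qed.

Lemma ipHM_self a f : expands a f -> ipHM b f f = limn (wsum a) *: 1.
Proof.
move=> af; apply: (ipHM_eq af af).
under eq_fun do rewrite mul_conj_quat scalerA.
by apply: cvg_series_scale1; apply: cvg_wsum; case: af.
Qed.

Lemma sqr_ipnorm a f : expands a f -> ipnorm (ipHM b) f ^+ 2 = limn (wsum a).
Proof.
move=> af; rewrite /ipnorm (ipHM_self af) /= mulr1 sqr_sqrtr//.
have [as_ _] := af.
apply: le_trans (nondecreasing_cvgn_le (@wsum_nondecr a) (cvg_wsum as_) 0).
by rewrite /wsum /series /= big_geq.
Qed.

Lemma wsum_le_ipnorm a f n : expands a f -> wsum a n <= ipnorm (ipHM b) f ^+ 2.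
Proof.
move=> af; rewrite (sqr_ipnorm af).
apply: nondecreasing_cvgn_le; first exact: wsum_nondecr.
by apply: cvg_wsum; case: af.
Qed.

Lemma ipnorm_ge0 f : 0 <= ipnorm (ipHM b) f.
Proof. exact: sqrtr_ge0. Qed.

Lemma ipnorm_le a f (e : R) : 0 <= e -> expands a f ->
  (forall n, wsum a n <= e ^+ 2) -> ipnorm (ipHM b) f <= e.
Proof.
move=> e0 af ae; rewrite -(@ler_pXn2r _ 2)// ?nnegrE ?ipnorm_ge0//.
rewrite (sqr_ipnorm af); apply: limr_le; last exact: nearW.
by apply: cvg_wsum; case: af.
Qed.

(** The weights being at least 1, the norm controls each coefficient uniformly in
    the index: this yields both coefficientwise convergence of Cauchy sequences
    and bounded evaluations. *)
Lemma coef_le_ipnorm a f k : expands a f -> `|a k| <= ipnorm (ipHM b) f.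
Proof.
move=> af; rewrite -(@ler_pXn2r _ 2)// ?nnegrE ?ipnorm_ge0//.
exact: le_trans (coef_le_wsum a k) (wsum_le_ipnorm _ af).
Qed.

Lemma HM_right_subspace : is_right_subspace (HM b).
Proof.
split.
- exact: HM_expands expands0.
- by move=> f g /Qcoef_HM ef /Qcoef_HM eg; exact: HM_expands (expandsD ef eg).
- by move=> f x /Qcoef_HM ef; exact: HM_expands (expandsZ x ef).
Qed.

Lemma ipHM_right_inner_product : is_right_inner_product (ipHM b) (HM b).
Proof.
split.
- move=> f g h /Qcoef_HM ef /Qcoef_HM eg /Qcoef_HM eh.
  apply: (ipHM_eq ef (expandsD eg eh)).
  rewrite (_ : (fun k => _) =
    (fun k => b k *: (quat_conj (Qcoef b f k) * Qcoef b g k)) +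
    (fun k => b k *: (quat_conj (Qcoef b f k) * Qcoef b h k))).
    by rewrite seriesD; apply: cvgD; exact: ipHM_cvg.
  by apply/funext => k; rewrite !fctE mulrDr scalerDr.
- move=> f g x /Qcoef_HM ef /Qcoef_HM eg.
  apply: (ipHM_eq ef (expandsZ x eg)).
  under eq_fun do rewrite mulrA scalerAl.
  by apply: cvg_series_mulq; exact: ipHM_cvg.
- move=> f g /Qcoef_HM ef /Qcoef_HM eg.
  apply: (ipHM_eq eg ef).
  under eq_fun do rewrite -[Qcoef b f _]quat_conjK -quat_conjM -quat_conjZ.
  by apply: cvg_series_conj; exact: ipHM_cvg.
- move=> f /Qcoef_HM ef.
  by rewrite (ipHM_self ef) /= mulr1 -(sqr_ipnorm ef) sqr_ge0.
- move=> f /Qcoef_HM ef f0.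
  have nf : ipnorm (ipHM b) f = 0 by rewrite /ipnorm f0 sqrtr0.
  have c0 : Qcoef b f = 0.
    apply/funext => k; apply/eqP; rewrite -normr_le0 -nf.
    exact: coef_le_ipnorm.
  have [_ fs] := ef; have [_ zs] := expands0.
  apply/funext => q; rewrite c0 in fs.
  by rewrite -(cvg_lim _ (fs q))// -(cvg_lim _ (zs q)).
Qed.

Lemma cvg_wsum_coef (A : nat -> nat -> quat R) a n :
    (forall k, A ^~ k @ \oo --> a k) ->
  (fun m => wsum (A m) n) @ \oo --> wsum a n.
Proof.
move=> Aa; apply: cvg_big => [|k _]; first exact: add_continuous.
apply: cvgM; first exact: cvg_cst.
by under eq_fun do rewrite expr2; rewrite expr2; apply: cvgM; exact: cvg_norm.
Qed.

(** A Cauchy sequence has coefficients [A n] that converge, index by index, to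
    some [a].  The partial sums of the weighted squares of [A n - A m] are at most
    [e ^+ 2] for large [m] and [n]; a partial sum has finitely many terms, so the
    bound survives the limit in [m].  Hence [A n - a], and therefore [a], is
    summable, and [u n] tends to the function with coefficients [a]. *)
Lemma HM_complete : is_ip_complete (ipHM b) (HM b).
Proof.
move=> u /(_ _)/Qcoef_HM uA; set A := fun n => Qcoef b (u n) in uA => uC.
have AC (e : R) : 0 < e -> exists N, forall m n, (N <= m)%N -> (N <= n)%N ->
    forall K, wsum (A m - A n) K <= e ^+ 2.
  move=> /uC[N NC]; exists N => m n Nm Nn K.
  rewrite (le_trans (wsum_le_ipnorm K (expandsB (uA m) (uA n))))//.
  have uNe := NC m n Nm Nn.
  by rewrite lerXn2r ?nnegrE ?ipnorm_ge0// ltW// (le_lt_trans _ uNe)// ipnorm_ge0.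
have Acvg k : exists l : quat R, A ^~ k @ \oo --> l.
  suff Ak : cvgn (A ^~ k) by exists (limn (A ^~ k)).
  apply/cauchy_cvgP/cauchyP => e /uC[N NC]; exists (A N k).
  exists N => // n /= Nn; rewrite -ball_normE /=.
  exact: le_lt_trans (coef_le_ipnorm k (expandsB (uA N) (uA n))) (NC _ _ _ Nn).
have [a Aa] := choice Acvg.
have Aclose (e : R) : 0 < e -> exists N, forall n, (N <= n)%N ->
    forall K, wsum (A n - a) K <= e ^+ 2.
  move=> /AC[N NC]; exists N => n Nn K.
  have cA : (fun m => wsum (A n - A m) K) @ \oo --> wsum (A n - a) K.
    by apply: cvg_wsum_coef => k; apply: cvgB => //; exact: cvg_cst.
  rewrite -(cvg_lim _ cA)//; apply: limr_le; first exact: cvgP cA.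
  by exists N => // m /= Nm; exact: NC.
have as_ : b_summable b a.
  have [N NC] := Aclose 1 ltr01.
  have -> : a = A N + (fun k => (A N - a) k * -1).
    by apply/funext => k; rewrite !fctE mulrN1 opprB addrC subrK.
  apply: summableD; first by have [] := uA N.
  by apply: summable_mulr; apply/b_summableP; exists (1 ^+ 2); exact: NC.
have ef := expands_series as_.
eexists; first exact: HM_expands ef.
apply/cvgrPdist_le => e e0; have [N NC] := Aclose e e0.
exists N => // n /= Nn.
rewrite sub0r normrN ger0_norm ?ipnorm_ge0//.
apply: ipnorm_le (expandsB (uA n) ef) _; first exact: ltW.
exact: NC.
Qed.

(** * The reproducing kernel *)

(** Coefficients bounded by the norm of [f] give
    [|f q| <= sum_k |q|^k |f| = |f| / (1 - |q|)]. *)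
Lemma HM_bounded_evaluations : has_bounded_evaluations (ipHM b) (HM b).
Proof.
move=> q; exists (1 - `|val q|)^-1 => f /Qcoef_HM ef.
have [_ bd] := Qseries_bounded q (fun k => coef_le_ipnorm k ef).
have [_ /(_ q) fq] := ef.
by rewrite mulrC -(cvg_lim _ fq).
Qed.

Definition kernel_coef (p : B) (k : nat) : quat R :=
  (b k)^-1 *: quat_conj (Q k p).

(** The weighted squares are [|Q k p|^2 / b k <= (|p|^2)^k]. *)
Lemma summable_kernel_coef p : b_summable b (kernel_coef p).
Proof.
apply/b_summableP; exists (1 - `|val p| ^+ 2)^-1 => n.
have p1 : `|(`|val p| ^+ 2)| < 1.
  by rewrite ger0_norm ?exprn_ge0// exprn_ilt1// (valP p).
have := cvg_geometric_series p1 => /(_ 1); rewrite mul1r => gl.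
rewrite -(cvg_lim _ gl)//; apply: le_trans (nondecreasing_cvgn_le _ _ n).
- apply: ler_sum => k _; rewrite /kernel_coef normrZ normq_conj exprMn.
  rewrite gtr0_norm ?invr_gt0 ?b_gt0// /geometric /= mul1r.
  have -> : b k * ((b k)^-1 ^+ 2 * `|Q k p| ^+ 2) = (b k)^-1 * `|Q k p| ^+ 2.
    by field; rewrite gt_eqF ?b_gt0.
  apply: (@le_trans _ _ (`|Q k p| ^+ 2)).
    by rewrite ler_piMl ?exprn_ge0// invf_le1 ?b_gt0// b_ge1.
  by rewrite exprAC lerXn2r ?nnegrE ?exprn_ge0// normq_Q.
- by apply: nondecreasing_series => k _ _; rewrite /geometric/= mul1r !exprn_ge0.
- exact: cvgP gl.
Qed.

Lemma Q_kernel_coef q p : (fun k => Q k q * kernel_coef p k) = Kterm b q p.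
Proof. by apply/funext => k; rewrite /kernel_coef /Kterm -scalerAr. Qed.

Lemma expands_K p : expands (kernel_coef p) ((K b)^~ p).
Proof.
split=> [|q]; first exact: summable_kernel_coef.
have := @is_Qsum_series _ (summable_kernel_coef p) q.
by rewrite Q_kernel_coef.
Qed.

Lemma cvg_Kterm q p : cvgn (series (Kterm b q p)).
Proof.
have [_ /(_ q) Kq] := expands_K p.
by rewrite -Q_kernel_coef; exact: cvgP Kq.
Qed.

(** Conjugating the coefficient [(b k)^-1 *: quat_conj (Q k p)] gives back
    [Q k p], and its factor cancels the weight: the inner product with [f] is
    the series of [f p]. *)
Lemma K_reproducing : is_reproducing_kernel (ipHM b) (HM b) (K b).
Proof.
move=> p; have eK := expands_K p; split; first exact: HM_expands eK.
move=> f /Qcoef_HM ef; apply: (ipHM_eq eK ef).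
rewrite (_ : (fun k => _) = (fun k => Q k p * Qcoef b f k)); first by case: ef.
apply/funext => k; rewrite /kernel_coef quat_conjZ quat_conjK -scalerAl scalerA.
by rewrite divff ?scale1r// gt_eqF// b_gt0.
Qed.

(** * The orthonormal basis *)

Lemma sqrt_b_gt0 k : 0 < Num.sqrt (b k).
Proof. by rewrite sqrtr_gt0 b_gt0. Qed.

Lemma scaler_psi k x :
  scaler (psi b k) x = (fun q => Q k q * ((Num.sqrt (b k))^-1 *: x)).
Proof. by apply/funext => q; rewrite /scaler /psi -scalerAr -scalerAl. Qed.

Lemma expands_psi k :
  expands (fun j => if j == k then (Num.sqrt (b k))^-1 *: 1 else 0) (psi b k).
Proof.
have -> : psi b k = (fun q => Q k q * ((Num.sqrt (b k))^-1 *: 1)).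
  by rewrite -scaler_psi; apply/funext => q; rewrite /scaler mulr1.
exact: expands_monomial.
Qed.

Lemma psi_orthonormal j k : ipHM b (psi b j) (psi b k) = (j == k)%:R.
Proof.
apply: (ipHM_eq (expands_psi j) (expands_psi k)).
rewrite (_ : (fun i => _) = (fun i => if i == k then (j == k)%:R else 0)).
  exact: cvg_series_delta.
apply/funext => i; case: (i =P k) => [->|_]; last by rewrite mulr0 scaler0.
rewrite eq_sym; case: eqP => [->|_]; last by rewrite raddf0 mul0r scaler0.
rewrite mul_conj_quat scalerA normrZ normq1 mulr1 gtr0_norm ?invr_gt0 ?sqrt_b_gt0//.
rewrite exprVn sqr_sqrtr ?divff ?scale1r// ?gt_eqF ?b_gt0//.
by rewrite ltW// b_gt0.
Qed.

Lemma expands_partial_sum a n :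
  expands (fun k => if (k < n)%N then a k else 0)
    (\sum_(k < n) scaler (psi b k) (Num.sqrt (b k) *: a k)).
Proof.
elim: n => [|n IHn]; first by rewrite big_ord0; exact: expands0.
rewrite big_ord_recr /=.
have -> : (fun k => if (k < n.+1)%N then a k else 0) =
    (fun k => if (k < n)%N then a k else 0) + (fun k => if k == n then a n else 0).
  apply/funext => k; rewrite fctE ltnS leq_eqVlt.
  by case: ltngtP => [||->]; rewrite ?addr0 ?add0r.
apply: expandsD IHn _.
rewrite scaler_psi scalerA mulVf ?gt_eqF ?sqrt_b_gt0// scale1r.
exact: expands_monomial.
Qed.

(** The two sequences have disjoint supports.  The maximum makes the cut at [n]
    fall inside the range of summation. *)
Lemma wsum_tail a n m :
  wsum (a - (fun k => if (k < n)%N then a k else 0)) m + wsum a n <=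
  wsum a (maxn m n).
Proof.
set t := (X in wsum (_ - X)).
apply: (@le_trans _ _ (wsum (a - t) (maxn m n) + wsum a n)).
  by rewrite lerD2r wsum_nondecr// leq_maxl.
rewrite /wsum /series /= (big_cat_nat (leq0n n) (leq_maxr m n)) /=.
rewrite [X in _ <= X](big_cat_nat (leq0n n) (leq_maxr m n)) /=.
rewrite big_nat big1 => [|k /andP[_ kn]]; last first.
  by rewrite !fctE /t kn subrr normr0 expr0n mulr0.
rewrite add0r [leRHS]addrC lerD2r le_eqVlt; apply/orP; left; apply/eqP.
by apply: eq_big_nat => k /andP[nk _]; rewrite !fctE /t ltnNge nk /= subr0.
Qed.

(** The squared distance from [f] to its [n]-th partial sum is the tail of the
    series of weighted squares, which is small for some [n].  The coefficients
    are multiplied by [sqrt (b k)] to undo the normalisation of [psi]. *)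
Lemma psi_total f (e : R) : HM b f -> 0 < e -> exists n c,
  ipnorm (ipHM b) (f - \sum_(k < n) scaler (psi b k) (c k)) < e.
Proof.
move=> /Qcoef_HM ef e0; set a := Qcoef b f in ef.
have [as_ _] := ef; have wa := cvg_wsum as_.
have e2 : 0 < (e / 2) ^+ 2 by rewrite exprn_gt0// divr_gt0.
have /cvgrPdist_le/(_ _ e2)[n _ /(_ n (leqnn n)) an] := wa.
exists n, (fun k => Num.sqrt (b k) *: a k).
apply: (@le_lt_trans _ _ (e / 2)); last by rewrite ltr_pdivrMr// ltr_pMr// ltr1n.
apply: ipnorm_le (expandsB ef (expands_partial_sum a n)) _.
  by rewrite ltW// divr_gt0.
move=> m; rewrite (le_trans _ an)//; apply: le_trans (ler_norm _).
rewrite lerBrDr (le_trans (wsum_tail a n m))//.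
exact: nondecreasing_cvgn_le (@wsum_nondecr a) wa _.
Qed.

End Coefficients.

Theorem theorem5p2 (R : realType) (b : nat -> R)
    (b_nondecr : {homo b : m n / (m <= n)%N >-> m <= n}) (b0 : b 0%N = 1) :
  [/\ (* the sums defining the elements of HM converge on the ball *)
      forall a, b_summable b a -> exists f, is_Qsum a f,
      (* the inner product is given by any expansions of its arguments *)
      forall a c f g, b_summable b a -> b_summable b c ->
        is_Qsum a f -> is_Qsum c g ->
        series (fun k => b k *: (quat_conj (a k) * c k)) @ \oo --> ipHM b f g,
      is_rkhs (ipHM b) (HM b),
      (forall q p, cvgn (series (Kterm b q p))) /\
        is_reproducing_kernel (ipHM b) (HM b) (K b)
    & is_orthonormal_basis (ipHM b) (HM b) (psi b)].
Proof.
split.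
- by move=> a as_; eexists; exact: is_Qsum_series as_.
- by move=> a c f g as_ cs af cg; exact: ipHM_cvg.
- split; last exact: HM_bounded_evaluations.
  split; [exact: HM_right_subspace|exact: ipHM_right_inner_product|].
  exact: HM_complete.
- by split; [exact: cvg_Kterm|exact: K_reproducing].
- split; [|exact: psi_orthonormal|].
  + by move=> k; exact: HM_expands (expands_psi _ _ k).
  + by move=> f fHM e e0; exact: psi_total.
Qed.
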